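(* Let $n,b,c,d,e$ be nonnegative integers. Then \[\sum_{k=0}^n \binom{n}{k}^2\frac{\binom{k+bn}{k}\binom{k+cn}{k}\binom{k+dn}{k}\binom{k+en}{k}}{\binom{n+bn}{k}\binom{n+cn}{k}\binom{n+dn}{k}\binom{n+en}{k}}\Big\{1+(n-2k)\big(2H_k-H_{bn+k}-H_{cn+k}-H_{dn+k}-H_{en+k}\big)\Big\}\] \[= \frac{\binom{1+bn+dn+n}{n}}{\binom{n+bn}{n}\binom{n+dn}{n}}\sum_{\ell=0}^n\binom{n}{\ell}\frac{\binom{\ell+bn}{\ell}\binom{\ell+dn}{\ell}\binom{1+cn+en+n}{\ell}}{\binom{n+cn}{\ell}\binom{n+en}{\ell}\binom{1+bn+dn+\ell}{\ell}}.\]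
   Context: $H_0=0$ and $H_m=\sum_{j=1}^m \frac{1}{j}$ for positive integers $m$ (classical harmonic numbers). *)

(* Defs.v *)
From mathcomp Require Import all_boot all_order all_algebra.

Set Implicit Arguments.
Unset Strict Implicit.
Unset Printing Implicit Defensive.

Import GRing.Theory.
Local Open Scope ring_scope.

Definition harmonic_number (m : nat) : rat := \sum_(1 <= j < m.+1) j%:R^-1.

(* Binomial coefficients as rational numbers, so that the quotients of
   binomials are exact divisions in [rat]. *)
Definition binq (m k : nat) : rat := ('C(m, k)%N)%:R.

(* Main.v *)
Require Import Defs.
From mathcomp Require Import all_boot all_order all_algebra.
From mathcomp Require Import ring.
Import GRing.Theory.
Local Open Scope ring_scope.

(** Write [(x)_k] for the rising factorial.  The sum on the left is the derivative
    at [x = 0] of the very-well-poised sum in Whipple's transformation of a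
    terminating 7F6 into a 4F3, taken at [a = x - n] with the four free parameters
    [bn + 1 + x], ..., [en + 1 + x]; the denominator parameters [1 + a - b] are
    then independent of [x].  The other side of Whipple's identity carries the
    factor [(a)_(2n+1)], which has a simple zero at [x = 0], so its derivative is
    just the value there of the remaining factors.  The derivative produces
    [H_(n-k)] where the theorem has [- H_k]; the symmetry [k -> n - k] of the
    summand exchanges them and removes the constants [H_(bn)], ..., [H_(en)].

    Whipple's identity itself is proved with denominators cleared, in any
    commutative ring: expand one pair of parameters by the Pfaff-Saalschuetz sum,
    exchange the summations, and evaluate the inner sum by Dougall's 5F4. *)

(** * Rising factorials over a commutative ring *)

Section RisingFactorial.
Variable R : comNzRingType.
Implicit Types a b c d e p q u x : R.

Definition rising x k : R := \prod_(i < k) (x + i%:R).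

Lemma rising0 x : rising x 0 = 1.
Proof. by rewrite /rising big_ord0. Qed.

Lemma risingSr x k : rising x k.+1 = rising x k * (x + k%:R).
Proof. by rewrite /rising big_ord_recr. Qed.

Lemma risingD x j k : rising x (j + k) = rising x j * rising (x + j%:R) k.
Proof.
elim: k => [|k IH]; first by rewrite addn0 rising0 mulr1.
by rewrite addnS !risingSr IH natrD; ring.
Qed.

Lemma risingS x k : rising x k.+1 = x * rising (x + 1) k.
Proof. by rewrite -add1n risingD risingSr rising0 mul1r addr0. Qed.

Lemma risingSl x i k :
  rising (x + i%:R) k.+1 = (x + i%:R) * rising (x + i.+1%:R) k.
Proof. by rewrite risingS -addrA natr1. Qed.

(** Subtraction is taken in [R], so the recurrence needs no bound on [j]. With Pascal's rule, it
    drives both certificate computations. *)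
Lemma binS_mul (k j : nat) :
  j.+1%:R * 'C(k, j.+1)%:R = (k%:R - j%:R) * 'C(k, j)%:R :> R.
Proof.
have [le_jk|lt_kj] := leqP j k.
  by rewrite -natrB // -!natrM mul_bin_left.
by rewrite !bin_small ?mulr0 // ltnW.
Qed.

(** * The Pfaff-Saalschuetz sum *)

(** The [j]-th term of the balanced 3F2 with upper parameters [-k], [a + k], [p + q - 1 - a] and
    lower parameters [p], [q], multiplied by [(p)_k (q)_k]. *)
Definition saalschutz_term a p q k j : R :=
  'C(k, j)%:R * (-1) ^+ j * rising (a + k%:R) j * rising (p + q - 1 - a) j
  * rising (p + j%:R) (k - j) * rising (q + j%:R) (k - j).

(* The right-hand side is the Wilf-Zeilberger certificate of the recurrence in [k]
   satisfied by the full sum; it vanishes beyond [i = k]. *)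
Lemma saalschutz_partial a p q k i : (i <= k)%N ->
  \sum_(j < i.+1) (saalschutz_term a p q k.+1 j
     - (1 + a - p + k%:R) * (1 + a - q + k%:R) * saalschutz_term a p q k j)
  = (a + 2 * k%:R + 1) * (-1) ^+ i * 'C(k, i)%:R
    * rising (p + q - 1 - a) i.+1 * rising (a + k.+1%:R) i
    * rising (p + i%:R) (k - i) * rising (q + i%:R) (k - i).
Proof.
elim: i => [_|i IH lt_ik].
  rewrite big_ord1 /saalschutz_term !bin0 !subn0 !risingSr !rising0 !addr0.
  by ring.
rewrite big_ord_recr /= IH ?(ltnW lt_ik) // /saalschutz_term.
have [r kE] : exists r, k = (i.+1 + r)%N by exists (k - i.+1)%N; rewrite subnKC.
have -> : (k.+1 - i.+1 = r.+1)%N by rewrite kE -addnS addKn.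
have -> : (k - i = r.+1)%N by rewrite kE addSnnS addKn.
have -> : (k - i.+1 = r)%N by rewrite kE addKn.
rewrite binS natrD (risingSl a k) (risingSr (a + _)) (risingSr _ i.+1).
rewrite !(risingSl _ i) !(risingSr (_ + i.+1%:R)).
(* The two sides differ by an explicit multiple of the relation [binS_mul]. *)
apply: subr0_eq; set X := LHS.
have -> : X = (-1) ^+ i * rising (p + q - 1 - a) i.+1
    * rising (a + k.+1%:R) i * rising (p + i.+1%:R) r * rising (q + i.+1%:R) r
    * ((a + 2 * k%:R + 1) * (p + q + k%:R + i%:R)
        - (p + k%:R) * (q + k%:R))
    * (i.+1%:R * 'C(k, i.+1)%:R - (k%:R - i%:R) * 'C(k, i)%:R).
  rewrite /X.
  move: (rising _ _) (rising _ _) (rising _ _) (rising _ _) => f1 f2 f3 f4.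
  move: ('C(_, _)%:R) ('C(_, _)%:R) => c0 c1.
  rewrite exprS kE; ring.
by rewrite binS_mul subrr mulr0.
Qed.

(** Induction on [k]: the certificate at [i = k] covers the terms [j <= k] of the next sum, and its
    last term [j = k + 1] is added separately. *)
Lemma saalschutz a p q k :
  \sum_(j < k.+1) saalschutz_term a p q k j
  = rising (1 + a - p) k * rising (1 + a - q) k.
Proof.
elim: k => [|k IH].
  by rewrite big_ord1 /saalschutz_term bin0 !rising0 expr0 !mulr1.
have := saalschutz_partial a p q _ _ (leqnn k).
rewrite subnn !rising0 binn sumrB -mulr_sumr IH => /eqP; rewrite subr_eq => /eqP E.
rewrite big_ord_recr /= E /saalschutz_term subnn !rising0 binn !risingSr.
rewrite exprS -[k.+1%:R]natr1.
by ring.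
Qed.

(** * Dougall's 5F4 sum *)

(** The [i]-th term of the very-well-poised 5F4 with parameters [a], [1 + a/2], [1 + a - p],
    [1 + a - q], [-m], multiplied by [a (a + m + 1)_m (p)_m (q)_m]. The factor [a + 2i] avoids
    halving [a]. *)
Definition dougall_term a p q m i : R :=
  'C(m, i)%:R * (-1) ^+ i * (a + 2 * i%:R) * rising a i
  * rising (a + m%:R + 1 + i%:R) (m - i)
  * rising (1 + a - p) i * rising (1 + a - q) i
  * rising (p + i%:R) (m - i) * rising (q + i%:R) (m - i).

(* Wilf-Zeilberger certificate, as in [saalschutz_partial]. *)
Lemma dougall_partial a p q m i : (i <= m)%N ->
  \sum_(j < i.+1) (dougall_term a p q m.+1 j
     - (a + 2 * m%:R + 1) * (a + 2 * m%:R + 2) * (p + q - 1 - a + m%:R)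
       * dougall_term a p q m j)
  = (-1) ^+ i * 'C(m, i)%:R * rising a i.+1
    * rising (1 + a - p) i.+1 * rising (1 + a - q) i.+1
    * rising (a + m%:R + 1 + i.+1%:R) (m.+1 - i)
    * rising (p + i%:R) (m - i) * rising (q + i%:R) (m - i).
Proof.
(* Since [m = j + r], the factors [a + 2m + 1] and [a + 2m + 2] are exactly the next two of the
   rising factorial on the left. *)
have split_end r j : m = (j + r)%N ->
  (a + 2 * m%:R + 1) * (a + 2 * m%:R + 2) * rising (a + m%:R + 1 + j%:R) r
  = (a + m%:R + 1 + j%:R) * rising (a + m%:R + 1 + j.+1%:R) r.+1.
  move=> mE; rewrite -risingSl !risingSr; move: (rising _ _) => f.
  by rewrite mE; ring.
have shift_start j : a + m.+1%:R + 1 + j%:R = a + m%:R + 1 + j.+1%:R.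
  by rewrite -[m.+1%:R]natr1 -[j.+1%:R]natr1; ring.
elim: i => [_|i IH lt_im].
  rewrite big_ord1 /dougall_term !bin0 !subn0 shift_start.
  have := split_end m 0%N erefl; rewrite !addr0; set f := rising _ m; set g := rising _ m.+1.
  move=> E; rewrite !risingSr !rising0.
  apply: subr0_eq; set X := LHS.
  have -> : X = - (p + q - 1 - a + m%:R) * a * rising p m * rising q m
      * ((a + 2 * m%:R + 1) * (a + 2 * m%:R + 2) * f - (a + m%:R + 1) * g).
    by rewrite /X /= !addr0; ring.
  by rewrite E subrr mulr0.
rewrite big_ord_recr /= IH ?(ltnW lt_im) // /dougall_term shift_start.
have [r mE] : exists r, m = (i.+1 + r)%N by exists (m - i.+1)%N; rewrite subnKC.
have -> : (m.+1 - i.+1 = r.+1)%N by rewrite mE -addnS addKn.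
have -> : (m.+1 - i = r.+2)%N by rewrite mE -addnS addSnnS addKn.
have -> : (m - i = r.+1)%N by rewrite mE addSnnS addKn.
have -> : (m - i.+1 = r)%N by rewrite mE addKn.
have := split_end _ _ mE.
rewrite binS natrD (risingSl (a + _ + _) i.+1 r.+1) !(risingSr _ i.+1).
rewrite !(risingSl _ i) !(risingSr (_ + i.+1%:R) r).
set f := rising (a + m%:R + 1 + i.+1%:R) r.
set g := rising (a + m%:R + 1 + i.+2%:R) r.+1 => E.
(* The difference is a combination of two vanishing expressions, one from [binS_mul] and one from
   [split_end]. *)
apply: subr0_eq; set X := LHS.
have -> : X = (-1) ^+ i.+1 * rising a i.+1
    * rising (1 + a - p) i.+1 * rising (1 + a - q) i.+1
    * rising (p + i.+1%:R) r * rising (q + i.+1%:R) r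
    * (((1 + a - p) * (1 + a - q)
         - (a + 2 * i.+1%:R) * (p + q - 1 - a + m%:R)
         - (a + i.+1%:R) * (2 + 2 * a - p - q + i.+1%:R))
        * g * (i.+1%:R * 'C(m, i.+1)%:R - (m%:R - i%:R) * 'C(m, i)%:R)
      - 'C(m, i.+1)%:R * (a + 2 * i.+1%:R) * (p + q - 1 - a + m%:R)
        * ((a + 2 * m%:R + 1) * (a + 2 * m%:R + 2) * f
           - (a + m%:R + 1 + i.+1%:R) * g)).
  rewrite {}/X {E}; clearbody f g.
  move: (rising _ _) (rising _ _) (rising _ _) (rising _ _) (rising _ _)
    => f1 f2 f3 f4 f5.
  move: ('C(_, _)%:R) ('C(_, _)%:R) => c0 c1.
  by rewrite exprS mE; ring.
by rewrite binS_mul E !subrr !mulr0 subrr mulr0.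
Qed.

Lemma dougall5 a p q m :
  \sum_(j < m.+1) dougall_term a p q m j
  = rising a m.*2.+1 * rising (p + q - 1 - a) m.
Proof.
elim: m => [|m IH].
  rewrite big_ord1 /dougall_term /= subnn bin0 double0 risingSr !rising0.
  by rewrite !mulr0n !addr0; ring.
have := dougall_partial a p q _ _ (leqnn m).
rewrite subnn subSnn !rising0 binn sumrB -mulr_sumr IH => /eqP.
rewrite subr_eq => /eqP E.
rewrite big_ord_recr /= E /dougall_term subnn !rising0 binn doubleS.
rewrite !(risingSr _ m.*2.+2) !(risingSr _ m.*2.+1) (risingSr (p + q - 1 - a)).
rewrite (risingSr (_ + _ + _)) rising0 -!addnn.
move: (rising a (m + m).+1) => f; rewrite !exprS.
by ring.
Qed.

(** * Whipple's transformation *)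

Lemma sum_triangle (F : nat -> nat -> R) n :
  \sum_(k < n.+1) \sum_(j < k.+1) F k j
  = \sum_(j < n.+1) \sum_(i < (n - j).+1) F (j + i)%N j.
Proof.
elim: n => [|n IH]; first by rewrite !big_ord1.
rewrite big_ord_recr /= IH [RHS]big_ord_recr /= subnn big_ord1 addn0.
rewrite [X in _ + X]big_ord_recr /= addrA -big_split /=; congr (_ + _).
apply: eq_bigr => j _; rewrite subSn -1?ltnS // [RHS]big_ord_recr /=.
by rewrite -subSn -1?ltnS // subnKC // ltnW.
Qed.

(** Both sides are the trinomial coefficient [(j + i + r)! / (j! i! r!)]. *)
Lemma bin_trinomial (j i r : nat) :
  ('C(j + i + r, j + i) * 'C(j + i, j) = 'C(j + i + r, j) * 'C(i + r, i))%N.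
Proof.
have pos : (0 < j`! * i`! * r`!)%N by rewrite !muln_gt0 !fact_gt0.
apply/eqP; rewrite -(eqn_pmul2r pos); apply/eqP.
have E1 := bin_fact (leq_addr r (j + i)%N).
have E2 := bin_fact (leq_addr i j).
have E3 : ('C(j + i + r, j) * (j`! * (i + r)`!) = (j + i + r)`!)%N.
  by have := bin_fact (leq_addr (i + r)%N j); rewrite addnA -addnA addKn.
have E4 := bin_fact (leq_addr r i).
rewrite !addKn in E1 E2 E4.
transitivity (j + i + r)`!%N.
  by rewrite -E1 -E2; ring.
by rewrite -E3 -E4; ring.
Qed.

(* With [b = 1 + a - p], this is [(b)_k / (1 + a - b)_k] times [(1 + a - b)_n]. *)
Definition well_poised_pair a p n k : R :=
  rising (1 + a - p) k * rising (p + k%:R) (n - k).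

Lemma whipple a p q r s n :
  \sum_(k < n.+1) 'C(n, k)%:R * (-1) ^+ k * (a + 2 * k%:R) * rising a k
    * rising (a + n%:R + 1 + k%:R) (n - k)
    * (well_poised_pair a p n k * well_poised_pair a q n k
       * well_poised_pair a r n k * well_poised_pair a s n k)
  = rising a n.*2.+1 * \sum_(j < n.+1) 'C(n, j)%:R
    * rising (q + s - 1 - a) j * rising (p + r - 1 - a) (n - j)
    * (rising (1 + a - p) j * rising (1 + a - r) j)
    * (rising (q + j%:R) (n - j) * rising (s + j%:R) (n - j)).
Proof.
(* [saalschutz] at [q], [s] expands the product [(1 + a - q)_k (1 + a - s)_k] taken from the pairs
   of [q] and [s]. *)
pose T k j := 'C(n, k)%:R * (-1) ^+ k * (a + 2 * k%:R) * rising a k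
  * rising (a + n%:R + 1 + k%:R) (n - k)
  * (well_poised_pair a p n k * well_poised_pair a r n k)
  * (rising (q + k%:R) (n - k) * rising (s + k%:R) (n - k))
  * saalschutz_term a q s k j.
transitivity (\sum_(k < n.+1) \sum_(j < k.+1) T k j).
  apply: eq_bigr => k _; rewrite /T -mulr_sumr saalschutz /well_poised_pair.
  by ring.
rewrite sum_triangle mulr_sumr; apply: eq_bigr => -[j /= ltj] _.
have {}ltj : (j <= n)%N by [].
(* After [k = j + i], these are the factors free of [i]; the rest is a Dougall term with [a] shifted
   by [2j] and [p], [r] by [j]. *)
pose c := 'C(n, j)%:R * rising (q + s - 1 - a) j * rising a j.*2
  * (rising (1 + a - p) j * rising (1 + a - r) j)
  * (rising (q + j%:R) (n - j) * rising (s + j%:R) (n - j)).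
transitivity (\sum_(i < (n - j).+1)
    c * dougall_term (a + j.*2%:R) (p + j%:R) (r + j%:R) (n - j) i).
  apply: eq_bigr => -[i /= lei] _; rewrite ltnS in lei.
  have [t nE] : exists t, n = (j + i + t)%N.
    by exists (n - j - i)%N; rewrite -addnA subnKC // subnKC.
  rewrite /T /c /dougall_term /saalschutz_term /well_poised_pair {c T}.
  have -> : (n - (j + i) = t)%N by rewrite nE addKn.
  have -> : (n - j - i = t)%N by rewrite nE -!addnA !addKn.
  have -> : (n - j = i + t)%N by rewrite nE -!addnA addKn.
  rewrite addKn.
  have binE : 'C(n, j + i)%:R * 'C(j + i, j)%:R
      = 'C(n, j)%:R * 'C(i + t, i)%:R :> R.
    by rewrite nE -!natrM bin_trinomial.
  have -> : 1 + (a + j.*2%:R) - (p + j%:R) = 1 + a - p + j%:R.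
    by rewrite -addnn; ring.
  have -> : 1 + (a + j.*2%:R) - (r + j%:R) = 1 + a - r + j%:R.
    by rewrite -addnn; ring.
  have -> : a + j.*2%:R + (i + t)%:R + 1 + i%:R = a + n%:R + 1 + (j + i)%:R.
    by rewrite nE -addnn; ring.
  have aE : rising a (j + i) * rising (a + (j + i)%:R) j
      = rising a j.*2 * rising (a + j.*2%:R) i.
    by rewrite -!risingD addnAC addnn.
  have addE x : x + j%:R + i%:R = x + (j + i)%:R by rewrite natrD addrA.
  have splitE x : rising (x + j%:R) (i + t)
      = rising (x + j%:R) i * rising (x + (j + i)%:R) t.
    by rewrite risingD addE.
  have signE : (-1) ^+ (j + i) * (-1) ^+ j = (-1) ^+ i :> R.
    by rewrite -signr_odd -(signr_odd _ j) -(signr_odd _ i) oddD -signr_addb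
      addbAC addbb.
  rewrite !splitE !addE !(risingD (1 + a - _)).
  have -> : a + j.*2%:R + 2 * i%:R = a + 2 * (j + i)%:R.
    by rewrite -addnn; ring.
  apply: subr0_eq; set X := LHS.
  move: binE signE aE @X.
  move: ('C(n, j + i)%:R) ('C(j + i, j)%:R) ('C(n, j)%:R) ('C(i + t, i)%:R)
    => c1 c2 c3 c4.
  move: ((-1) ^+ (j + i)) ((-1) ^+ j) ((-1) ^+ i) => s1 s2 s3.
  move: (rising a (j + i)) (rising (a + (j + i)%:R) j) (rising a j.*2)
    (rising (a + j.*2%:R) i) => a1 a2 a3 a4.
  move: (rising _ _) (rising _ _) (rising _ _) (rising _ _) (rising _ _)
   (rising _ _) (rising _ _) (rising _ _) (rising _ _) (rising _ _)
   (rising _ _) (rising _ _) => f1 f2 f3 f4 f5 f6 f7 f8 f9 f10 f11 f12.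
  move=> binE signE aE.
  by ring: binE signE aE.
rewrite -mulr_sumr dougall5 /c.
have -> : p + j%:R + (r + j%:R) - 1 - (a + j.*2%:R) = p + r - 1 - a.
  by rewrite -addnn; ring.
have -> : rising a n.*2.+1
    = rising a j.*2 * rising (a + j.*2%:R) (n - j).*2.+1.
  by rewrite -risingD addnS -doubleD subnKC.
by ring.
Qed.

End RisingFactorial.

(** * Rising factorials and harmonic sums at integers *)

Local Notation H := harmonic_number.

Lemma harmonicS m : H m.+1 = H m + m.+1%:R^-1.
Proof. by rewrite /harmonic_number big_nat_recr. Qed.

Lemma natr_neq0 m : (0 < m)%N -> m%:R != 0 :> rat.
Proof. by rewrite Num.Theory.pnatr_eq0 lt0n. Qed.

Lemma factr_neq0 m : m`!%:R != 0 :> rat.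
Proof. exact: natr_neq0 (fact_gt0 m). Qed.

Lemma rising_pos m k : rising rat m.+1%:R k = (m + k)`!%:R / m`!%:R.
Proof.
elim: k => [|k IH]; first by rewrite rising0 addn0 divff ?factr_neq0.
by rewrite risingSr IH addnS factS natrM mulrC -natrD addSn mulrA.
Qed.

Lemma rising_neg m k : (k <= m)%N ->
  rising rat (- m%:R) k = (-1) ^+ k * m`!%:R / (m - k)`!%:R.
Proof.
elim: k => [_|k IH lt_km].
  by rewrite rising0 subn0 expr0 mul1r divff ?factr_neq0.
have mkE : (m - k = (m - k.+1).+1)%N by rewrite -subSn.
have ->: rising rat (- m%:R) k.+1 = - rising rat (- m%:R) k * (m - k)%:R.
  by rewrite risingSr natrB ?(ltnW lt_km)//; ring.
rewrite IH ?(ltnW lt_km) // mkE factS natrM exprS.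
have := natr_neq0 (m - k.+1).+1 isT; move: (_.+1%:R) => z z0.
by field; rewrite factr_neq0 z0.
Qed.

Lemma harmonic_pos m k :
  \sum_(i < k) (m.+1%:R + i%:R)^-1 = H (m + k) - H m.
Proof.
elim: k => [|k IH]; first by rewrite big_ord0 addn0 subrr.
by rewrite big_ord_recr /= IH addnS harmonicS -natrD addSn; ring.
Qed.

Lemma harmonic_neg m k : (k <= m)%N ->
  \sum_(i < k) (- m%:R + i%:R)^-1 = H (m - k) - H m.
Proof.
elim: k => [_|k IH lt_km]; first by rewrite big_ord0 subn0 subrr.
have mkE : (m - k = (m - k.+1).+1)%N by rewrite -subSn.
rewrite big_ord_recr /= IH ?(ltnW lt_km) // mkE harmonicS -mkE.
have -> : - m%:R + k%:R = - (m - k)%:R :> rat.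
  by rewrite natrB ?(ltnW lt_km) // opprB addrC.
by rewrite invrN; ring.
Qed.

(** * Logarithmic derivatives at zero *)

(* Storing [P'(0)] as [u * h] keeps [h], the logarithmic derivative at [0],
   additive on products even when [u] vanishes. *)
Definition log_deriv0 (P : {poly rat}) u h := P.[0] = u /\ P^`().[0] = u * h.

Lemma log_deriv0M P Q u v h g : log_deriv0 P u h -> log_deriv0 Q v g ->
  log_deriv0 (P * Q) (u * v) (h + g).
Proof.
move=> [P0 P1] [Q0 Q1]; split; first by rewrite hornerM P0 Q0.
by rewrite derivM hornerD !hornerM P0 P1 Q0 Q1; ring.
Qed.

Lemma log_deriv0C c : log_deriv0 c%:P c 0.
Proof. by split; rewrite ?derivC !hornerE. Qed.

(** Each factor [X + c + i] has derivative 1, which must be its value [c + i] times the inverse;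
    hence the nonvanishing condition. *)
Lemma log_deriv0_rising P c k : P = 'X + c%:P ->
  (forall i : nat, (i < k)%N -> c + i%:R != 0) ->
  log_deriv0 (rising _ P k) (rising _ c k) (\sum_(i < k) (c + i%:R)^-1).
Proof.
move=> ->; elim: k => [|k IH] nz.
  by rewrite !rising0 big_ord0; apply: log_deriv0C.
rewrite !risingSr big_ord_recr /=; apply: log_deriv0M.
  by apply: IH => i ltik; apply/nz/ltnW.
have := nz k (leqnn _) => nzk; split; first by rewrite !hornerE hornerMn !hornerE.
rewrite -polyC_natr -addrA -polyCD derivD derivX derivC !hornerE.
by rewrite mulfV.
Qed.

Lemma rising_polyC c k : rising {poly rat} c%:P k = (rising _ c k)%:P.
Proof.
by elim: k => [|k IH]; rewrite ?rising0 // !risingSr IH polyCM polyCD polyC_natr.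
Qed.

Lemma horner0_rising P c k : P.[0] = c -> (rising {poly rat} P k).[0] = rising _ c k.
Proof.
move=> P0; elim: k => [|k IH]; first by rewrite !rising0 hornerC.
by rewrite !risingSr hornerM IH hornerD P0 -polyC_natr hornerC.
Qed.

(** Reversing the sum shows that it equals its own opposite, and 2 is invertible in [rat]. *)
Lemma sum_antisym (f : nat -> rat) n :
  (forall k, (k <= n)%N -> f (n - k)%N = - f k) -> \sum_(k < n.+1) f k = 0.
Proof.
move=> fN; have : \sum_(k < n.+1) f k = - \sum_(k < n.+1) f k.
  rewrite {1}(reindex_inj rev_ord_inj) /= -sumrN; apply: eq_bigr => k _.
  by rewrite subSS fN // -ltnS.
by move/eqP; rewrite -subr_eq0 opprK -mulr2n Num.Theory.mulrn_eq0 /= => /eqP.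
Qed.

(** * The well-poised summand at [a = X - n] *)

Lemma binq_fact m k : (k <= m)%N -> binq m k = m`!%:R / (k`!%:R * (m - k)`!%:R).
Proof.
move=> le_km; rewrite /binq -(bin_fact le_km) !natrM.
by field; rewrite !factr_neq0.
Qed.

Lemma signr_sqr k : (-1) ^+ k * (-1) ^+ k = 1 :> rat.
Proof. by rewrite -expr2 sqrr_sign. Qed.

(** Here [1 + a - p] is [X + B + 1] while [p] is constant, so only the first rising factorial
    contributes to the logarithmic derivative. *)
Lemma log_deriv0_well_poised_pair n B k : (k <= n)%N ->
  log_deriv0 (well_poised_pair _ ('X - n%:R) (- (n + B)%:R) n k)
    ((-1) ^+ (n - k) * ((n + B)`!%:R / B`!%:R)
      * (binq (k + B) k / binq (n + B) k))
    (H (B + k) - H B).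
Proof.
move=> le_kn; rewrite /well_poised_pair -[H (B + k) - _]addr0.
have -> : (-1) ^+ (n - k) * ((n + B)`!%:R / B`!%:R)
      * (binq (k + B) k / binq (n + B) k)
    = rising rat B.+1%:R k * rising rat (- (n + B - k)%:R) (n - k).
  rewrite rising_pos rising_neg; last by rewrite leq_sub2r ?leq_addr.
  rewrite !binq_fact ?leq_addr // ?(leq_trans le_kn) ?leq_addr //.
  rewrite addKn -subnDA subnKC // addKn (addnC B k).
  by field; rewrite !factr_neq0.
have -> : rising {poly rat} (- (n + B)%:R + k%:R) (n - k)
    = (rising rat (- (n + B - k)%:R) (n - k))%:P.
  rewrite -rising_polyC natrB ?(leq_trans le_kn) ?leq_addr //.
  by rewrite opprB polyCB !polyC_natr addrC.
apply: log_deriv0M; last exact: log_deriv0C.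
rewrite -harmonic_pos; apply: log_deriv0_rising => [|i _].
  by rewrite polyC_natr -[B.+1%:R]natr1 natrD; ring.
by rewrite -natrD natr_neq0 // addSn.
Qed.

(** The letters [b], [c], [d], [e] are arbitrary naturals here; the theorem substitutes the
    multiples [b * n], ..., [e * n]. *)
Definition summand n b c d e k : rat :=
  binq n k ^+ 2
  * ((binq (k + b) k * binq (k + c) k * binq (k + d) k * binq (k + e) k)
     / (binq (n + b) k * binq (n + c) k * binq (n + d) k * binq (n + e) k)).

Definition fact_ratio n b : rat := (n + b)`!%:R / b`!%:R.

(** The factor [a + 2k] is left out: its value [2k - n] at 0 may vanish, and then it has no
    logarithmic derivative. The constants [H n] of the two single rising factorials cancel. *)
Lemma log_deriv0_summand n b c d e k : (k <= n)%N ->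
  let a : {poly rat} := 'X - n%:R in
  log_deriv0 ('C(n, k)%:R * (-1) ^+ k * (rising _ a k
      * rising _ (a + n%:R + 1 + k%:R) (n - k)
      * (well_poised_pair _ a (- (n + b)%:R) n k
         * well_poised_pair _ a (- (n + c)%:R) n k
         * well_poised_pair _ a (- (n + d)%:R) n k
         * well_poised_pair _ a (- (n + e)%:R) n k)))
    (n`!%:R * (fact_ratio n b * fact_ratio n c * fact_ratio n d * fact_ratio n e)
       * summand n b c d e k)
    (H (n - k) - H k + (H (b + k) - H b + (H (c + k) - H c)
       + (H (d + k) - H d) + (H (e + k) - H e))).
Proof.
move=> le_kn a.
have aD : log_deriv0 (rising _ a k) (rising _ (- n%:R) k) (H (n - k) - H n).
  rewrite -harmonic_neg //; apply: log_deriv0_rising => [|i ltik].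
    by rewrite polyCN polyC_natr.
  have lt_in := leq_trans ltik le_kn.
  by rewrite addrC subr_eq0 eq_sym -subr_eq0 -natrB ?(ltnW lt_in) // natr_neq0 // subn_gt0.
have oneD : log_deriv0 (rising _ (a + n%:R + 1 + k%:R) (n - k))
    (rising _ k.+1%:R (n - k)) (H n - H k).
  have -> : H n - H k = H (k + (n - k)) - H k by rewrite subnKC.
  rewrite -harmonic_pos; apply: log_deriv0_rising => [|i _].
    by rewrite polyC_natr /a -[k.+1%:R]natr1; ring.
  by rewrite -natrD natr_neq0 // addSn.
have signD : log_deriv0 ('C(n, k)%:R * (-1) ^+ k) (binq n k * (-1) ^+ k) 0.
  have -> : 'C(n, k)%:R * (-1) ^+ k = (binq n k * (-1) ^+ k)%:P.
    by rewrite polyCM polyC_natr rmorphXn /= polyCN polyC1.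
  exact: log_deriv0C.
have pairD B := log_deriv0_well_poised_pair n B k le_kn.
have := log_deriv0M _ _ _ _ _ _ signD (log_deriv0M _ _ _ _ _ _
  (log_deriv0M _ _ _ _ _ _ aD oneD) (log_deriv0M _ _ _ _ _ _
    (log_deriv0M _ _ _ _ _ _ (log_deriv0M _ _ _ _ _ _ (pairD b) (pairD c))
      (pairD d)) (pairD e))).
rewrite rising_neg // rising_pos subnKC // add0r.
set u := (X in log_deriv0 _ X _); set v := (X in log_deriv0 _ _ X) => uv.
have -> : H (n - k) - H k + (H (b + k) - H b + (H (c + k) - H c)
    + (H (d + k) - H d) + (H (e + k) - H e)) = v by rewrite /v; ring.
suff <- : u = n`!%:R * (fact_ratio n b * fact_ratio n c * fact_ratio n d
    * fact_ratio n e) * summand n b c d e k by [].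
(* All signs occur in pairs. One binomial of the square is already present; the other is formed by
   the factorials of [(-n)_k] and [(k + 1)_(n - k)]. *)
have := signr_sqr (n - k); have := signr_sqr k.
rewrite /u /summand -/(fact_ratio _ _) expr2 {2}(binq_fact n k le_kn) !invfM.
rewrite -!/(fact_ratio _ _).
move: ((-1) ^+ k) ((-1) ^+ (n - k)) (binq n k) => s1 s2 c0 s1K s2K.
move: (k`!%:R^-1) ((n - k)`!%:R^-1) => f1 f2.
move: ((binq _ _)^-1) ((binq _ _)^-1) ((binq _ _)^-1) ((binq _ _)^-1).
by move=> y1 y2 y3 y4; ring: s1K s2K.
Qed.

(** * The 4F3 side at zero *)

Definition rhs_term n b c d e l : rat :=
  binq n l
  * ((binq (l + b) l * binq (l + d) l * binq (1 + c + e + n) l)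
     / (binq (n + c) l * binq (n + e) l * binq (1 + b + d + l) l)).

(** The left side is the term of the second sum in [whipple] at [a = -n], with [p], [q], [r], [s]
    the negatives of [n + b], [n + c], [n + d], [n + e]; this order pairs [b] with [d] and [c] with
    [e]. *)
Lemma rhs_termE n b c d e l : (l <= n)%N ->
  'C(n, l)%:R
    * rising rat (- (n + c)%:R - (n + e)%:R - 1 + n%:R) l
    * rising rat (- (n + b)%:R - (n + d)%:R - 1 + n%:R) (n - l)
    * (rising rat b.+1%:R l * rising rat d.+1%:R l)
    * (rising rat (- (n + c)%:R + l%:R) (n - l)
       * rising rat (- (n + e)%:R + l%:R) (n - l))
  = (-1) ^+ n * (fact_ratio n b * fact_ratio n c * fact_ratio n d * fact_ratio n e)
    / n`!%:R
    * (binq (1 + b + d + n) n / (binq (n + b) n * binq (n + d) n))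
    * rhs_term n b c d e l.
Proof.
move=> le_ln.
have sumE x y : - (n + x)%:R - (n + y)%:R - 1 + n%:R = - (1 + x + y + n)%:R :> rat.
  by ring.
have subE x : - (n + x)%:R + l%:R = - (n + x - l)%:R :> rat.
  by rewrite natrB ?(leq_trans le_ln) ?leq_addr // opprB addrC.
rewrite !sumE !subE !rising_pos !rising_neg; first last.
- by rewrite (leq_trans le_ln) // leq_addl.
- by rewrite (leq_trans (leq_subr _ _)) // leq_addl.
- by rewrite leq_sub2r ?leq_addr.
- by rewrite leq_sub2r ?leq_addr.
have addE x : (n + x - l - (n - l) = x)%N by rewrite -subnDA subnKC // addKn.
rewrite !addE /rhs_term /fact_ratio -/(binq n l).
rewrite !(binq_fact (n + _) l) ?(leq_trans le_ln) ?leq_addr //.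
rewrite !(binq_fact (n + _) n) ?leq_addr //.
rewrite !(binq_fact (l + _) l) ?leq_addr //.
rewrite (binq_fact (1 + b + d + n) n) ?leq_addl //.
rewrite (binq_fact (1 + b + d + l) l) ?leq_addl //.
rewrite (binq_fact (1 + c + e + n) l) ?(leq_trans le_ln) ?leq_addl //.
rewrite !addKn !addnK (_ : (1 + b + d + n - (n - l) = 1 + b + d + l)%N); last first.
  by rewrite -addnBA ?leq_subr // subKn.
have := signr_sqr (n - l); have := signr_sqr l.
have -> : (-1) ^+ n = (-1) ^+ l * (-1) ^+ (n - l) :> rat.
  by rewrite -exprD subnKC.
rewrite !(addnC l).
move: ((-1) ^+ l) ((-1) ^+ (n - l)) (binq n l) => s1 s2 c0 s1K s2K.
by field: s2K; rewrite !factr_neq0.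
Qed.

(** * Differentiating Whipple's identity at zero *)

Lemma deriv0_mulX (P Q S : {poly rat}) :
  (P * 'X * Q * S)^`().[0] = P.[0] * Q.[0] * S.[0].
Proof. by rewrite !derivM derivX !hornerE; ring. Qed.

(** Used with [c = 2k - n]; the form without division by [c] covers the middle index, where
    [c = 0]. *)
Lemma deriv0_linear_mul c P u h : log_deriv0 P u h ->
  (('X + c%:P) * P)^`().[0] = u * (1 + c * h).
Proof.
move=> [P0 P1]; rewrite derivM derivD derivX derivC addr0 mul1r.
by rewrite hornerD hornerM P0 P1 hornerD hornerX hornerC; ring.
Qed.

Lemma derivative_identity n b c d e :
  \sum_(k < n.+1) summand n b c d e k
    * (1 + (2 * k%:R - n%:R)
         * (H (n - k) - H k + (H (b + k) - H b + (H (c + k) - H c)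
              + (H (d + k) - H d) + (H (e + k) - H e))))
  = binq (1 + b + d + n) n / (binq (n + b) n * binq (n + d) n)
    * \sum_(l < n.+1) rhs_term n b c d e l.
Proof.
set A := LHS; set B := RHS.
pose a : {poly rat} := 'X - n%:R.
pose w := fact_ratio n b * fact_ratio n c * fact_ratio n d * fact_ratio n e.
have wn0 : w != 0 by rewrite /w /fact_ratio !(mulf_neq0, invr_neq0, factr_neq0).
have := whipple _ a (- (n + b)%:R) (- (n + c)%:R) (- (n + d)%:R) (- (n + e)%:R) n.
set L := LHS; set S := (X in _ = _ * X) => LS.
have LE : L^`().[0] = n`!%:R * w * A.
  rewrite /L /A raddf_sum /= horner_sum mulr_sumr.
  apply: eq_bigr => -[k /= le_kn] _; rewrite ltnS in le_kn.
  have := deriv0_linear_mul (2 * k%:R - n%:R) _ _ _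
    (log_deriv0_summand n b c d e k le_kn).
  have <- : a + 2 * k%:R = 'X + (2 * k%:R - n%:R)%:P.
    by rewrite polyCB polyCM !polyC_natr /a; ring.
  rewrite -/a -/w => E; rewrite [RHS]mulrA -E; congr (_^`().[0]).
  by rewrite !mulrA; congr (_ * _ * _ * _ * _ * _); ring.
have SE : S.[0] = (-1) ^+ n * w / n`!%:R * B.
  rewrite /S /B horner_sum !mulr_sumr.
  apply: eq_bigr => -[l /= le_ln] _; rewrite ltnS in le_ln.
  rewrite [RHS]mulrA /w -rhs_termE //.
  have horn x y : (- (n + x)%:R - (n + y)%:R - 1 - a).[0]
      = - (n + x)%:R - (n + y)%:R - 1 + n%:R.
    by rewrite /a -!polyC_natr !hornerE; ring.
  have hornS x : (1 + a - - (n + x)%:R).[0] = x.+1%:R.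
    have -> : 1 + a - - (n + x)%:R = 'X + x.+1%:R.
      by rewrite /a -[x.+1%:R]natr1 natrD; ring.
    by rewrite -polyC_natr hornerD hornerX hornerC add0r.
  have hornl x : (- (n + x)%:R + l%:R : {poly rat}).[0] = - (n + x)%:R + l%:R.
    by rewrite -!polyC_natr !hornerE.
  rewrite !hornerM -polyC_natr hornerC.
  by rewrite !(horner0_rising _ _ _ (horn _ _), horner0_rising _ _ _ (hornS _),
    horner0_rising _ _ _ (hornl _)).
have : L^`().[0] = (-1) ^+ n * n`!%:R * n`!%:R * S.[0].
  (* This splits [(a)_(2n+1)] as [(a)_n * X * (X + 1)_n], whose outer factors take the values
     [(-1)^n n!] and [n!] at 0. *)
  rewrite LS -addnn -addnS risingD risingS.
  have -> : a + n%:R = 'X by rewrite /a subrK.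
  rewrite !mulrA deriv0_mulX.
  have a0 : a.[0] = - n%:R by rewrite /a -polyC_natr !hornerE.
  rewrite (horner0_rising _ _ _ a0) rising_neg // subnn.
  have X1 : ('X + 1 : {poly rat}).[0] = 1%:R by rewrite !hornerE.
  by rewrite (horner0_rising _ _ _ X1) rising_pos add0n fact0 !divr1.
rewrite LE SE => E.
apply: (mulfI (mulf_neq0 (factr_neq0 n) wn0)); rewrite E.
have := signr_sqr n; move: ((-1) ^+ n) => s s2.
by field: s2; rewrite factr_neq0.
Qed.

(** * Reversal symmetry and conclusion *)

Lemma summand_rev n b c d e k : (k <= n)%N ->
  summand n b c d e (n - k) = summand n b c d e k.
Proof.
move=> le_kn.
(* The ratio equals [(k + x)! (n + x - k)! / (x! (n + x)!)], which is symmetric under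
   [k -> n - k]. *)
have revE x : binq (n - k + x) (n - k) / binq (n + x) (n - k)
    = binq (k + x) k / binq (n + x) k.
  rewrite !binq_fact ?leq_addr // ?(leq_trans (leq_subr _ _)) ?leq_addr //;
    last by rewrite (leq_trans le_kn) ?leq_addr.
  rewrite !addKn -!addnBAC ?leq_subr // subKn //.
  by field; rewrite !factr_neq0.
have factor l : summand n b c d e l = binq n l ^+ 2
  * ((binq (l + b) l / binq (n + b) l) * (binq (l + c) l / binq (n + c) l)
    * (binq (l + d) l / binq (n + d) l) * (binq (l + e) l / binq (n + e) l)).
  by rewrite /summand !invfM; congr (_ * _); ring.
by rewrite !factor !revE /binq bin_sub.
Qed.

Theorem theorem8 (n b c d e : nat) :
  \sum_(0 <= k < n.+1)
     binq n k ^+ 2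
     * ((binq (k + b * n) k * binq (k + c * n) k
         * binq (k + d * n) k * binq (k + e * n) k)
        / (binq (n + b * n) k * binq (n + c * n) k
           * binq (n + d * n) k * binq (n + e * n) k))
     * (1 + (n%:R - 2 * k%:R)
            * (2 * harmonic_number k
               - harmonic_number (b * n + k) - harmonic_number (c * n + k)
               - harmonic_number (d * n + k) - harmonic_number (e * n + k)))
  = binq (1 + b * n + d * n + n) n / (binq (n + b * n) n * binq (n + d * n) n)
    * \sum_(0 <= l < n.+1)
         binq n l
         * ((binq (l + b * n) l * binq (l + d * n) l
             * binq (1 + c * n + e * n + n) l)
            / (binq (n + c * n) l * binq (n + e * n) l
               * binq (1 + b * n + d * n + l) l)).
Proof.
rewrite !big_mkord -[RHS]derivative_identity.
set B := (b * n)%N; set C := (c * n)%N; set D := (d * n)%N; set E := (e * n)%N.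
(* [f] is the summand of [derivative_identity] minus that of the theorem. It is antisymmetric: only
   [2k - n] changes, by a sign, under [k -> n - k]. *)
pose f k := summand n B C D E k * ((2 * k%:R - n%:R)
  * (H k + H (n - k) - (H B + H C + H D + H E))).
rewrite -[LHS]addr0 -[X in _ + X = _](sum_antisym f n) => [|k le_kn].
  by rewrite -big_split /=; apply: eq_bigr => k _; rewrite /f /summand; ring.
by rewrite /f summand_rev // subKn // natrB //; ring.
Qed.
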